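(* Let $\Omega\subset\mathbb{R}^N$ be a convex domain and let $\alpha\in[0,1]$, $\alpha\neq 0$. Then an $\alpha$-convex function $u:\overline{\Omega}\to\mathbb{R}$ is Lipschitz continuous in $\Omega$. Moreover, a function $u:\overline{\Omega}\to\mathbb{R}$ is $\alpha$-convex if and only if it satisfies $$\mathcal{L}_\alpha u(z):=\inf_{\substack{x,y\in\overline{\Omega}\\ z=t_0x+(1-t_0)y}} L_\alpha(u)(t_0)\ \ge\ 0,\qquad z\in\Omega,$$ in the viscosity sense, touching with $1$-dimensional test functions. Here $L_\alpha(u)(t_0)$ stands for $L_\alpha$ applied to $u(tx+(1-t)y)$ as a function of $t\in(0,1)$, at the point $t_0$.
   Context: For $\alpha\in[0,1]$ and a function $v$ of one real variable, $L_\alpha(v)(t)=\alpha v''(t)+(1-\alpha)|v'(t)|^2$. $\alpha$-convexity: a function $u:\overline{\Omega}\to\mathbb{R}$ is $\alpha$-convex if for any two points $x,y\in\overline{\Omega}$ one has $u(tx+(1-t)y)\le v(t)$ for all $t\in(0,1)$, where $v$ is the solution of $L_\alpha(v)(t)=0$ for $t\in(0,1)$ with $v(0)=u(y)$, $v(1)=u(x)$. Viscosity sense ($1$-dimensional tests): an upper semicontinuous function $u$ satisfies $\mathcal{L}_\alpha u\ge 0$ in $\Omega$ in the viscosity sense (is a viscosity subsolution of $\mathcal{L}_\alpha u=0$) if for any $z\in\Omega$, any pair $x,y\in\Omega$ such that $z=t_0x+(1-t_0)y$ for some $t_0\in(0,1)$, and any test function $\phi\in C^2(\mathbb{R})$ such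 that $\phi(t_0)=u(z)$ and $\phi(t)\ge u(tx+(1-t)y)$ for $t\in(0,1)$, one has $L_\alpha\phi(t_0)\ge 0$. The authors also phrase this as: for any $z\in\Omega$ and any $x,y\in\overline{\Omega}$ with $z=t_0x+(1-t_0)y$ for some $t_0\in(0,1)$, the function $w(t)=u(tx+(1-t)y)$ is a viscosity subsolution of the one-dimensional problem $L_\alpha w=0$ in $(0,1)$.
   Formalization: ''Lipschitz continuous in Ω'' is proved on compact subsets of Ω (global fails); the converse of the ''iff'' assumes u upper semicontinuous on the closure and continuous, relative to it, at boundary points interior to segments of the closure (false otherwise). *)

(* Defs.v *)
From HB Require Import structures.
From mathcomp Require Import all_boot all_order all_algebra.
From mathcomp Require Import all_classical all_reals all_analysis.
From mathcomp Require Import ring.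

Set Implicit Arguments.
Unset Strict Implicit.
Unset Printing Implicit Defensive.

Import Order.TTheory GRing.Theory Num.Theory.
Import numFieldNormedType.Exports.

Local Open Scope classical_set_scope.
Local Open Scope ring_scope.

(* [derive1] is total, so [Lop alpha v t] is meaningful only where [v] is
   twice differentiable; it is always paired with [C2_on] below. *)
Definition Lop (R : realType) (alpha : R) (v : R -> R) (t : R) : R :=
  alpha * derive1n 2 v t + (1 - alpha) * `|derive1 v t| ^+ 2.

(* Two-sided derivatives: this is C^2 regularity on [A] for open [A]. *)
Definition C2_on (R : realType) (A : set R) (v : R -> R) : Prop :=
  forall t, A t ->
    [/\ derivable v t 1, derivable (derive1 v) t 1
      & {for t, continuous (derive1n 2 v)}].

Definition dirichlet_solution (R : realType) (alpha a b : R) (v : R -> R) :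
    Prop :=
  [/\ C2_on `]0, 1[ v, {within `[0, 1], continuous v},
      forall t, t \in `]0, 1[ -> Lop alpha v t = 0
    & v 0 = a /\ v 1 = b].

Lemma C2_on_explicit (R : realType) (A : set R) (f f1 f2 : R -> R) :
  open A ->
  (forall t, A t -> is_derive t (1 : R) f (f1 t)) ->
  (forall t, A t -> is_derive t (1 : R) f1 (f2 t)) ->
  (forall t, A t -> {for t, continuous f2}) ->
  [/\ C2_on A f, {in A, derive1 f =1 f1} & {in A, derive1n 2 f =1 f2}].
Proof.
move=> Ao df df1 cf2.
have E1 t : A t -> derive1 f t = f1 t.
  by move=> At; rewrite derive1E; have [] := df t At.
have N1 t : A t -> {near t, derive1 f =1 f1}.
  by move=> At; near=> s; apply: E1; near: s; exact: open_nbhs_nbhs.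
have E2 t : A t -> is_derive t (1 : R) (derive1 f) (f2 t).
  move=> At; apply: (@near_eq_is_derive _ _ _ f1) (df1 t At).
  by have := N1 t At; apply: filterS => s ->.
have E3 t : A t -> derive1n 2 f t = f2 t.
  by move=> At; rewrite /derive1n /= derive1E; have [] := E2 t At.
split=> [t At|t /set_mem/E1//|t /set_mem/E3//].
split.
- by have [] := df t At.
- by have [] := E2 t At.
- rewrite /prop_for /continuous_at (E3 t At).
  apply: cvg_trans (cf2 t At); apply: near_eq_cvg.
  have At' : \forall s \near t, A s by exact: open_nbhs_nbhs.
  by apply: filterS At' => s /E3 <-.
Unshelve. all: by end_near. Qed.

Lemma dirichlet_solution_exists (R : realType) (alpha a b : R) :
  0 < alpha -> alpha <= 1 -> exists v, dirichlet_solution alpha a b v.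
Proof.
move=> a0 a1.
have aff (c d : R) (t : R) : is_derive t (1 : R) (fun s => c + s * d) d.
  have K := is_deriveD (is_derive_cst c t (1 : R))
    (is_deriveM (is_derive_id t (1 : R)) (is_derive_cst d t (1 : R))).
  apply: (is_derive_eq K).
  by rewrite scaler0 !add0r /GRing.scale /= mulr1.
have oo : open (`]0, 1[%classic : set R) by exact: interval_open.
have [->|an1] := eqVneq alpha 1.
  exists (fun t => a + t * (b - a)).
  have cc (t : R) : `]0, 1[%classic t -> {for t, continuous (fun=> 0 : R)}.
    by move=> _; exact: cvg_cst.
  have [H1 H2 H3] := C2_on_explicit oo
    (fun t _ => aff a (b - a) t) (fun t _ => is_derive_cst (b - a) t (1 : R)) cc.
  split=> //; last by split; ring.
  - apply: continuous_subspaceT => t; apply: differentiable_continuous.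
    by apply/derivable1_diffP; have [] := aff a (b - a) t.
  - by move=> t t01; rewrite /Lop H3 ?inE//; ring.
have k0 : 0 < (1 - alpha) / alpha.
  by rewrite divr_gt0// subr_gt0 lt_neqAle an1.
set k := (1 - alpha) / alpha in k0.
have kn0 : k != 0 by rewrite gt_eqF.
set p := fun t => expR (k * a) + t * (expR (k * b) - expR (k * a)).
have p0 (t : R) : 0 <= t <= 1 -> 0 < p t.
  move=> /andP[t0 t1]; have A0 := expR_gt0 (k * a); have B0 := expR_gt0 (k * b).
  rewrite /p; move: (expR (k * a)) (expR (k * b)) A0 B0 => A B A0 B0.
  have -> : A + t * (B - A) = (1 - t) * A + t * B by ring.
  have [->|tn] := eqVneq t 1; first by rewrite subrr mul0r add0r mul1r.
  apply: ltr_pwDl; last by rewrite mulr_ge0// ltW.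
  by rewrite mulr_gt0// subr_gt0 lt_neqAle tn.
set D := expR (k * b) - expR (k * a) in p p0.
have dp (t : R) : is_derive t (1 : R) p D by exact: aff.
have dv (t : R) : 0 <= t <= 1 ->
    is_derive t (1 : R) (fun s => k^-1 * ln (p s)) (k^-1 * D / p t).
  move=> t01.
  have H := is_derive1_comp (is_derive1_ln (p0 t t01)) (dp t).
  have K := is_deriveZ k^-1 H.
  apply: (is_derive_eq K); by rewrite /GRing.scale /=; ring.
have dv1 (t : R) : 0 <= t <= 1 ->
   is_derive t (1 : R) (fun s => k^-1 * D / p s) (- k^-1 * (D / p t) ^+ 2).
  move=> t01; have pt := p0 t t01.
  have H : is_derive t (1 : R) (fun s => (p s)^-1) _ := is_deriveV (lt0r_neq0 pt) (dp t).
  have K := is_deriveZ (k^-1 * D) H.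
  apply: (is_derive_eq K); by rewrite /GRing.scale /=; field; rewrite ?kn0 lt0r_neq0.
have sub (t : R) : t \in `]0, 1[ -> 0 <= t <= 1.
  by rewrite in_itv/= => /andP[? ?]; rewrite !ltW.
exists (fun s => k^-1 * ln (p s)).
have cv (t : R) : `]0, 1[%classic t ->
    {for t, continuous (fun s => - k^-1 * (D / p s) ^+ 2)}.
  move=> /sub t01.
  have cp : {for t, continuous (fun s => D / p s)}.
    apply: cvgM; first exact: cvg_cst.
    apply: cvgV; first exact/lt0r_neq0/p0.
    apply: differentiable_continuous.
    by apply/derivable1_diffP; have [] := dp t.
  by apply: cvgM; [exact: cvg_cst|exact: (cvgM cp cp)].
have [H1 H2 H3] := C2_on_explicit oo
  (fun t t01 => dv t (sub t t01)) (fun t t01 => dv1 t (sub t t01)) cv.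
split=> //.
- apply: continuous_in_subspaceT => t /set_mem /= t01.
  apply: differentiable_continuous; apply/derivable1_diffP.
  suff t01' : 0 <= t <= 1 by have [] := dv t t01'.
  by move: t01; rewrite in_itv.
- move=> t t01; have pt := p0 t (sub t t01).
  rewrite /Lop H2 ?inE// H3 ?inE// real_normK ?num_real// /k.
  by field; rewrite !gt_eqF//= subr_gt0 lt_neqAle an1.
- by split; rewrite /p ?mul0r ?addr0 ?mul1r /D ?[expR (k * a) + _]addrC ?subrK expRK mulKf.
Qed.

Definition segpt (R : realType) (N : nat) (x y : 'rV[R]_N) (t : R) :
    'rV[R]_N :=
  t *: x + (1 - t) *: y.

(* A function on the closure of [Omega] is a total function whose values
   outside the closure are never used.

   For 0 < alpha <= 1 the Dirichlet problem has exactly one solution (existence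
   is [dirichlet_solution_exists] above), so quantifying over all solutions
   [v] speaks about "the" solution. At alpha = 0 there is none if u x <> u y,
   so the definition is not meant for that case. *)
Definition alpha_convex (R : realType) (N : nat) (alpha : R)
    (Omega : set 'rV[R]_N) (u : 'rV[R]_N -> R) : Prop :=
  forall x y, closure Omega x -> closure Omega y ->
  forall v, dirichlet_solution alpha (u y) (u x) v ->
  forall t, t \in `]0, 1[ -> u (segpt x y t) <= v t.

(* Semicontinuity of the restriction of [u] to [A]. *)
Definition usc_on (R : realType) (N : nat) (A : set 'rV[R]_N)
    (u : 'rV[R]_N -> R) : Prop :=
  forall x, A x -> forall c, u x < c ->
    \forall y \near within A (nbhs x), u y < c.

(* [L_alpha w (t0) >= 0] in the viscosity sense, for [w] on the interval
   ]0, 1[; the test functions are C^2 on the whole real line. *)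
Definition visc_Lop_ge0_at (R : realType) (alpha : R) (w : R -> R) (t0 : R) :
    Prop :=
  forall phi : R -> R, C2_on setT phi ->
    phi t0 = w t0 -> (forall t, t \in `]0, 1[ -> w t <= phi t) ->
    0 <= Lop alpha phi t0.

(* The infimum over pairs [x], [y] is nonnegative in the viscosity sense iff
   the one-dimensional condition holds for each pair. *)
Definition visc_subsolution (R : realType) (N : nat) (alpha : R)
    (Omega : set 'rV[R]_N) (u : 'rV[R]_N -> R) : Prop :=
  usc_on Omega u /\
  forall z, Omega z ->
  forall x y, closure Omega x -> closure Omega y ->
  forall t0, t0 \in `]0, 1[ -> z = segpt x y t0 ->
    visc_Lop_ge0_at alpha (fun t => u (segpt x y t)) t0.

(* Continuity of [u], relative to the closure, at the boundary points interior
   to a nondegenerate segment of the closure. Such a segment lies in the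
   boundary, where the viscosity condition tests nothing: on the open unit
   square, the indicator function of the midpoint of an edge is upper
   semicontinuous on the closed square and is a viscosity subsolution, but is
   not alpha-convex. The condition is void if [Omega] is strictly convex. *)
Definition continuous_on_flat_boundary (R : realType) (N : nat)
    (Omega : set 'rV[R]_N) (u : 'rV[R]_N -> R) : Prop :=
  forall x y t, closure Omega x -> closure Omega y -> x <> y ->
    t \in `]0, 1[ -> ~ Omega (segpt x y t) ->
    u @ within (closure Omega) (nbhs (segpt x y t)) --> u (segpt x y t).

(* A convex function need not be globally Lipschitz on the domain:
   -sqrt(1 - x^2) is convex on [-1, 1] and not Lipschitz on ]-1, 1[. *)
Definition lipschitz_on_compacts (R : realType) (N : nat)
    (Omega : set 'rV[R]_N) (u : 'rV[R]_N -> R) : Prop :=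
  forall K : set 'rV[R]_N, compact K -> K `<=` Omega ->
    [lipschitz u x | x in K].

(* Main.v *)
(** Let [k = (1 - alpha) / alpha] and let [g] be a primitive of [exp (k * s)].
    Then [(g o v)'' = exp (k * v) / alpha * L_alpha v], so that [u] is
    alpha-convex if and only if [g o u] is convex along the segments of the
    closure. The Lipschitz bound is that of finite-dimensional convex
    functions. Subsolutions: a test function touching [u] from above gives
    [g o phi] nonnegative second symmetric differences at the contact point.
    Conversely, if [g o u] exceeds its chord on a segment with interior in
    [Omega], then subtracting a small concave parabola gives an interior
    maximum, and a quartic corrected parabola, pulled back by [g], is a test
    function contradicting the viscosity inequality. Segments of the boundary
    are limits of segments in [Omega]; there semicontinuity controls the
    endpoints and the flat-boundary hypothesis controls the inner point. *)

Require Import Defs.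
From HB Require Import structures.
From mathcomp Require Import all_boot all_order all_algebra.
From mathcomp Require Import all_classical all_reals all_analysis.
From mathcomp Require Import ring lra.
Import Order.TTheory GRing.Theory Num.Theory.
Import numFieldNormedType.Exports.
Local Open Scope classical_set_scope.
Local Open Scope ring_scope.
Set Implicit Arguments.
Unset Strict Implicit.
Unset Printing Implicit Defensive.


(** * The linearizing change of variable *)

(* With [k = (1 - alpha) / alpha], the primitive of [expR (k * s)] vanishing
   at [0]; it turns [Lop alpha v = 0] into [(gexp k \o v)'' = 0]. *)
Definition gexp (R : realType) (k s : R) : R :=
  if k == 0 then s else (expR (k * s) - 1) / k.

(** The inverse of [gexp k], meaningful only where [0 < 1 + k * s], which is the range of
    [gexp k]. *)
Definition glog (R : realType) (k s : R) : R :=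
  if k == 0 then s else ln (1 + k * s) / k.

Section linearization.
Variables (R : realType) (k : R).
Implicit Types (s t : R) (v : R -> R).

Lemma is_derive_expRM s : is_derive s 1 (fun x => expR (k * x)) (k * expR (k * s)).
Proof.
have H : is_derive s 1 (fun x => k * x) k.
  apply: (is_derive_eq (is_deriveZ k (is_derive_id s (1 : R)))).
  by rewrite /GRing.scale /= mulr1.
apply: (is_derive_eq (is_derive1_comp (is_derive_expR (k * s)) H)).
by rewrite mulrC.
Qed.

Lemma is_derive_gexp s : is_derive s 1 (gexp k) (expR (k * s)).
Proof.
rewrite /gexp; case: eqVneq => [->|k0].
  by apply: (is_derive_eq (is_derive_id s (1 : R))); rewrite mul0r expR0.
have H := is_deriveD (is_derive_expRM s) (is_derive_cst (- 1 : R) s (1 : R)).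
have -> : (fun x : R => (expR (k * x) - 1) / k) =
    k^-1 *: ((fun x => expR (k * x)) \+ cst (- 1 : R)).
  by apply/funext => x; rewrite mulrC.
apply: (is_derive_eq (is_deriveZ k^-1 H)).
by rewrite addr0 /GRing.scale /= mulKf.
Qed.

Lemma is_derive_glog s : 0 < 1 + k * s ->
  is_derive s 1 (glog k) (1 + k * s)^-1.
Proof.
rewrite /glog; case: eqVneq => [->|k0] ks.
  by apply: (is_derive_eq (is_derive_id s (1 : R))); rewrite mul0r addr0 invr1.
have H : is_derive s 1 (fun x => 1 + k * x) k.
  have := is_deriveD (is_derive_cst (1 : R) s (1 : R))
    (is_deriveZ k (is_derive_id s (1 : R))).
  by move=> /is_derive_eq; apply; rewrite add0r /GRing.scale /= mulr1.
have -> : (fun x : R => ln (1 + k * x) / k) =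
    k^-1 *: (@ln R \o (fun x => 1 + k * x)).
  by apply/funext => x; rewrite mulrC.
have K := @is_derive1_comp R (@ln R) (fun x => 1 + k * x) s _ _
  (is_derive1_ln ks) H.
apply: (is_derive_eq (is_deriveZ k^-1 K)).
by rewrite /GRing.scale /= mulrCA mulVf// mulr1.
Qed.

Lemma glogK s : 0 < 1 + k * s -> gexp k (glog k s) = s.
Proof.
rewrite /gexp /glog; case: eqVneq => // k0 ks.
by rewrite [k * (_ / _)]mulrC divfK// lnK ?posrE// addrAC subrr add0r mulrC mulKf.
Qed.

(** The derivative of [gexp k] is thus an affine function of [gexp k] itself, and every value of
    [gexp k] lies in the domain of [glog k]. *)
Lemma gexpE s : 1 + k * gexp k s = expR (k * s).
Proof.
rewrite /gexp; case: eqVneq => [->|k0]; first by rewrite !mul0r expR0 addr0.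
by rewrite [k * (_ / _)]mulrC divfK// addrC subrK.
Qed.

Lemma continuous_gexp : continuous (gexp k).
Proof.
move=> s; apply: differentiable_continuous; apply/derivable1_diffP.
by have [] := is_derive_gexp s.
Qed.

Lemma gexp_MVT s t : s <= t ->
  exists2 c, s <= c <= t & gexp k t - gexp k s = expR (k * c) * (t - s).
Proof.
move=> st.
have [c ci ->] := MVT_segment st (fun x _ => is_derive_gexp x)
  (continuous_subspaceT continuous_gexp).
by exists c => //; move: ci; rewrite in_itv.
Qed.

Lemma gexp_lt : {homo gexp k : s t / s < t}.
Proof.
move=> s t st; have [c _ E] := gexp_MVT (ltW st).
by rewrite -subr_gt0 E mulr_gt0 ?expR_gt0// subr_gt0.
Qed.

Lemma gexp_ltE : {mono gexp k : s t / s < t}.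
Proof. exact/leW_mono/le_mono/gexp_lt. Qed.

Lemma gexp_leE : {mono gexp k : s t / s <= t}.
Proof. exact/le_mono/gexp_lt. Qed.

(** On [[-M, M]] the derivative [expR (k * c)] is at least [expR (- (k * M))], so the inverse of
    [gexp k] has Lipschitz constant [expR (k * M)] there. *)
Lemma dist_gexp (M s t : R) : 0 <= k -> `|s| <= M -> `|t| <= M ->
  `|s - t| <= expR (k * M) * `|gexp k s - gexp k t|.
Proof.
move=> k0; wlog st : s t / s <= t => [H sM tM|sM tM].
  have [/H|/ltW ts] := leP s t; first exact.
  by rewrite distrC (distrC (gexp k s)) H.
rewrite distrC (distrC (gexp k s)).
have [c /andP[sc ct] ->] := gexp_MVT st.
rewrite normrM (ger0_norm (expR_ge0 _)) mulrA -expRD -mulrDr.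
rewrite ler_peMl ?normr_ge0// -expR0 ler_expR mulr_ge0//.
by move: sM => /ler_normlP[]; lra.
Qed.

End linearization.

(** * Functions of one variable *)

Section one_variable.
Variable R : realType.
Implicit Types (f w v : R -> R) (a b s t : R).

(** The mean value theorem on [[0, t]] and on [[t, 1]] expresses both chord slopes as values of
    [w1], and a third application shows these values equal. Nothing is differentiated at the end
    points, where [w] is merely continuous. *)
Lemma derive2_eq0_affine w w1 :
  {within `[0, 1], continuous w} ->
  (forall t, t \in `]0, 1[ -> is_derive t 1 w (w1 t)) ->
  (forall t, t \in `]0, 1[ -> is_derive t 1 w1 0) ->
  forall t, t \in `]0, 1[ -> w t = t * w 1 + (1 - t) * w 0.
Proof.
move=> cw dw dw1 t; rewrite in_itv/= => /andP[t0 t1].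
have dw0 x : x \in `]0, t[ -> is_derive x 1 w (w1 x).
  rewrite in_itv/= => /andP[x0 xt]; apply: dw.
  by rewrite in_itv/= x0 (lt_trans xt).
have dw1' x : x \in `]t, 1[ -> is_derive x 1 w (w1 x).
  rewrite in_itv/= => /andP[x0 xt]; apply: dw.
  by rewrite in_itv/= xt (lt_trans t0).
have cw0 : {within `[0, t], continuous w}.
  by apply: continuous_subspaceW cw; apply: subset_itvl; rewrite bnd_simp ltW.
have cw1 : {within `[t, 1], continuous w}.
  by apply: continuous_subspaceW cw; apply: subset_itvr; rewrite bnd_simp ltW.
have [c1] := MVT t0 dw0 cw0.
have [c2] := MVT t1 dw1' cw1.
rewrite !in_itv/= => /andP[tc2 c21] E2 /andP[c10 c1t] E1.
have c12 : c1 < c2 by lra.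
have inI x : c1 <= x <= c2 -> x \in `]0, 1[.
  by move=> /andP[? ?]; rewrite in_itv/=; lra.
have ddw x : x \in `]c1, c2[ -> is_derive x 1 w1 0.
  by rewrite in_itv/= => /andP[? ?]; apply/dw1/inI; rewrite !ltW.
have cdw : {within `[c1, c2], continuous w1}.
  apply: derivable_within_continuous => x; rewrite in_itv/= => /inI/dw1 H.
  by have [] := H.
have [c _ E] := MVT c12 ddw cdw.
have {}E : w1 c2 = w1 c1 by move: E; rewrite mul0r; lra.
rewrite E in E2; rewrite subr0 in E1.
have -> : w t = w 0 + w1 c1 * t by lra.
have -> : w 1 = w 0 + w1 c1 by lra.
ring.
Qed.

Section gexp_comp.
Variables (k t v2 : R) (v dv : R -> R).
Hypotheses (dvt : is_derive t 1 v (dv t)) (ddvt : is_derive t 1 dv v2).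

Lemma is_derive_gexp_comp :
  is_derive t 1 (gexp k \o v) (expR (k * v t) * dv t).
Proof. exact: is_derive1_comp (is_derive_gexp k (v t)) dvt. Qed.

Lemma is_derive2_gexp_comp :
  is_derive t 1 (fun s => expR (k * v s) * dv s)
    (expR (k * v t) * (v2 + k * dv t ^+ 2)).
Proof.
have H := is_derive1_comp (is_derive_expRM k (v t)) dvt.
apply: (is_derive_eq (is_deriveM H ddvt)).
by rewrite /GRing.scale /=; ring.
Qed.

End gexp_comp.

Lemma LopE alpha v t : 0 < alpha ->
  Lop alpha v t = alpha * (derive1n 2 v t +
    (1 - alpha) / alpha * derive1 v t ^+ 2).
Proof.
by move=> a0; rewrite /Lop real_normK ?num_real//; field; rewrite gt_eqF.
Qed.

Lemma derivable_is_derive1 f t : derivable f t 1 -> is_derive t 1 f (derive1 f t).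
Proof. by move=> df; rewrite derive1E; exact: derivableP. Qed.

Lemma dirichlet_solution_gexp alpha a b v : 0 < alpha ->
  dirichlet_solution alpha a b v -> forall t, t \in `]0, 1[ ->
  let k := (1 - alpha) / alpha in
  gexp k (v t) = t * gexp k b + (1 - t) * gexp k a.
Proof.
move=> a0 [C2 cv Lv [<- <-]] t t01 k.
apply: (@derive2_eq0_affine (gexp k \o v)
  (fun s => expR (k * v s) * derive1 v s)) t01.
- apply: within_continuous_comp cv => x _; exact: continuous_gexp.
- move=> s s01; apply: is_derive_gexp_comp; apply: derivable_is_derive1.
  by have [] := C2 s s01.
- move=> s s01; have [d1 d2 _] := C2 s s01.
  have E : derive1n 2 v s + k * derive1 v s ^+ 2 = 0.
    by apply: (mulfI (lt0r_neq0 a0)); rewrite mulr0 -(Lv s s01) LopE.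
  have := is_derive2_gexp_comp (dv := derive1 v) k
    (derivable_is_derive1 d1) (derivable_is_derive1 d2).
  by move=> /is_derive_eq; apply; rewrite [X in _ * X]E mulr0.
Qed.

(** If [f2 t < 0], then [f2] is negative near [t]. Mean values on both sides of [t] write the second
    difference as [h * (f1 c1 - f1 c2)] with [c2 < c1], and a mean value of [f1] makes it
    negative. *)
Lemma symdiff_ge0_derive2 f f1 f2 t :
  (forall s, is_derive s 1 f (f1 s)) -> (forall s, is_derive s 1 f1 (f2 s)) ->
  {for t, continuous f2} ->
  (\forall h \near 0^'+, f t + f t <= f (t + h) + f (t - h)) -> 0 <= f2 t.
Proof.
move=> df df1 cf2 fh; rewrite leNgt; apply/negP => f2t.
have cf : continuous f.
  move=> s; apply: differentiable_continuous; apply/derivable1_diffP.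
  by have [] := df s.
have cf1 : continuous f1.
  move=> s; apply: differentiable_continuous; apply/derivable1_diffP.
  by have [] := df1 s.
have [e /= e0 He] : \forall s \near t, f2 s < 0 by exact: cvgr_lt cf2 _ f2t.
have : \forall h \near 0^'+, [/\ 0 < h, h < e & f t + f t <= f (t + h) + f (t - h)].
  near=> h; split; near: h => //; first exact: nbhs_right_gt.
  exact: nbhs_right_lt.
move=> /(@filter_ex _ _ _)[h [h0 he H]].
have th : t < t + h by lra.
have ht : t - h < t by lra.
have [c1] := MVT th (fun x _ => df x) (continuous_subspaceT cf).
have [c2] := MVT ht (fun x _ => df x) (continuous_subspaceT cf).
rewrite !in_itv/= => /andP[hc2 c2t] E2 /andP[tc1 c1h] E1.
have c21 : c2 < c1 by lra.
have [c] := MVT c21 (fun x _ => df1 x) (continuous_subspaceT cf1).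
rewrite in_itv/= => /andP[c2c cc1] E.
have f2c : f2 c < 0.
  by apply: He; rewrite /ball /= ltr_norml; apply/andP; split; lra.
have : f1 c1 - f1 c2 < 0 by rewrite E nmulr_rlt0// subr_gt0; lra.
have -> : f1 c1 - f1 c2 = (f (t + h) + f (t - h) - (f t + f t)) / h.
  by apply: (mulIf (lt0r_neq0 h0)); rewrite divfK ?gt_eqF//; lra.
by rewrite pmulr_llt0 ?invr_gt0//; lra.
Unshelve. all: by end_near. Qed.

(** Compactness, in the form of near coverings, is used twice: local bounds merge into a global
    upper bound, and, if the supremum were not attained, local gaps below it would merge into a
    uniform gap [e]. *)
Lemma usc_attains_max (T : topologicalType) (K : set T) (f : T -> R) :
  compact K -> K !=set0 ->
  (forall x, K x -> forall c, f x < c ->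
     \forall y \near within K (nbhs x), f y < c) ->
  exists2 x, K x & forall y, K y -> f y <= f x.
Proof.
move=> /compact_near_coveringP/near_covering_withinP cK [x0 Kx0] usc.
have [M HM] : exists M, forall x, K x -> f x <= M.
  have /(@filter_ex _ _ _)[M HM] : \forall M \near +oo, K `<=` (fun x => f x <= M).
    apply: cK => x Kx.
    have Hx : \forall y \near within K (nbhs x), f y < f x + 1.
      by apply: usc => //; lra.
    exists ([set y | K y -> f y < f x + 1], [set M | f x + 1 < M]).
      by split => //=; apply: nbhs_pinfty_gt; exact: num_real.
    by move=> [y M] /= [Hy HM] Ky; rewrite ltW// (lt_trans (Hy Ky)).
  by exists M => x /HM.
apply: contrapT => noatt.
have hs : has_sup [set f x | x in K].
  split; first by exists (f x0), x0.
  by exists M => _ [x Kx <-]; exact: HM.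
set S := sup [set f x | x in K].
have fS x : K x -> f x < S.
  move=> Kx; rewrite lt_neqAle; apply/andP; split; last first.
    by apply: sup_upper_bound => //; exists x.
  apply/eqP => E; apply: noatt; exists x => // y Ky; rewrite E.
  by apply: sup_upper_bound => //; exists y.
have /(@filter_ex _ _ _)[e [e0 He]] :
    \forall e \near 0^'+, 0 < e /\ K `<=` (fun x => f x < S - e).
  near=> e; split; first by near: e; exact: nbhs_right_gt.
  near: e; apply: cK => x Kx; have fxS := fS x Kx.
  have Hx : \forall y \near within K (nbhs x), f y < (f x + S) / 2.
    by apply: usc => //; lra.
  exists ([set y | K y -> f y < (f x + S) / 2], [set e | e < (S - f x) / 2]).
    by split => //=; apply: nbhs_right_lt; lra.
  by move=> [y e] /= [Hy He] Ky; have := Hy Ky; lra.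
have [_ [x Kx <-] ] := sup_adherent e0 hs.
by have := He x Kx; rewrite -/S; lra.
Unshelve. all: by end_near. Qed.

End one_variable.

(** * Comparison of one-dimensional viscosity subsolutions with chords *)

Section comparison.
Variable R : realType.
Implicit Types (w : R -> R) (k s t : R).

(** Completing squares: multiplied by [A], the quartic is a sum of two squares and [A ^+ 2 / 2]. The
    value of [q] makes the [h ^+ 2] terms match, and [C] is then read off from the [h ^+ 4] term. *)
Lemma quartic_gt0 k p0 p1 e : 0 <= k -> 0 < 1 + k * p0 ->
  exists2 C : R, 0 <= C &
    forall h, 0 < 1 + k * (p0 + p1 * h - e * h ^+ 2 + C * h ^+ 4).
Proof.
move=> k0 A0; pose A := 1 + k * p0; pose q := k * p1 ^+ 2 / A + e.
exists (k * q ^+ 2 / A) => [|h].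
  by apply: divr_ge0; [rewrite mulr_ge0 ?sqr_ge0|exact: ltW].
have -> : 1 + k * (p0 + p1 * h - e * h ^+ 2 + k * q ^+ 2 / A * h ^+ 4) =
    ((k * p1 * h + A / 2) ^+ 2 + (k * q * h ^+ 2 - A / 2) ^+ 2 + A ^+ 2 / 2) / A.
  by rewrite /q /A; field; rewrite gt_eqF.
apply: divr_gt0 => //; apply: ltr_wpDl; first by rewrite addr_ge0 ?sqr_ge0.
by rewrite divr_gt0// exprn_gt0.
Qed.

(** Since [gexp k \o phi] is [p], the second derivative of [p] is
    [expR (k * phi) * (phi'' + k * phi' ^+ 2)], and the exponential equals [1 + k * p]. *)
Lemma glog_horner_C2 k (p : {poly R}) :
  (forall s, 0 < 1 + k * p.[s]) -> let phi := glog k \o horner p in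
  C2_on setT phi /\ forall s,
    derive1n 2 phi s + k * derive1 phi s ^+ 2 = p^`()^`().[s] / (1 + k * p.[s]).
Proof.
move=> pos phi.
pose f1 s := p^`().[s] / (1 + k * p.[s]).
pose f2 s := p^`()^`().[s] / (1 + k * p.[s]) -
  k * (p^`().[s] / (1 + k * p.[s])) ^+ 2.
have dphi s : is_derive s 1 phi (f1 s).
  have H := is_derive1_comp (is_derive_glog (pos s)) (is_derive_poly p s).
  by apply: (is_derive_eq H); rewrite mulrC.
pose d : {poly R} := 1 + k *: p.
have dE s : d.[s] = 1 + k * p.[s] by rewrite /d !hornerE.
have ddE s : d^`().[s] = k * p^`().[s].
  by rewrite /d derivD derivZ derivC !hornerE.
have dn0 s : d.[s] != 0 by rewrite dE gt_eqF.
have df1 s : is_derive s 1 f1 (f2 s).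
  have H := is_deriveM (is_derive_poly p^`() s)
    (is_deriveV (dn0 s) (is_derive_poly d s)).
  have -> : f1 = horner p^`() \* (fun y => d.[y]^-1).
    by apply/funext => y; rewrite /f1 /= dE.
  apply: (is_derive_eq H); rewrite /GRing.scale /= ddE /f2 -dE.
  by field; exact: dn0.
have cf2 s : {for s, continuous f2}.
  have c1 (q : {poly R}) : {for s, continuous (fun s => q.[s] / (1 + k * p.[s]))}.
    apply: cvgM; first exact: continuous_horner.
    apply: cvgV; first by rewrite -dE.
    under eq_fun do rewrite -dE; rewrite -dE; exact: continuous_horner.
  apply: cvgB; first exact: c1.
  by apply: cvgM; [exact: cvg_cst|exact: (cvgM (c1 _) (c1 _))].
have [C2 E1 E2] := C2_on_explicit openT
  (fun t _ => dphi t) (fun t _ => df1 t) (fun t _ => cf2 t).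
split=> // s; rewrite E1 ?inE// E2 ?inE// /f1 /f2; ring.
Qed.

(** An increasing continuous function preserves upper semicontinuity. A general filter covers both
    restricted neighbourhoods and limits along segments. *)
Lemma usc_gexp (T : topologicalType) (F : set_system T) {FF : Filter F}
    (f : T -> R) k (b : R) :
  (forall c, b < c -> \forall y \near F, f y < c) ->
  forall c, gexp k b < c -> \forall y \near F, gexp k (f y) < c.
Proof.
move=> usc c bc.
have cv : gexp k (b + d) @[d --> 0^'+] --> gexp k b.
  apply: cvg_at_right_filter; rewrite -[in X in _ --> X](addr0 b).
  apply: continuous_cvg; first exact: continuous_gexp.
  by apply: cvgD; [exact: cvg_cst|exact: cvg_id].
have /(@filter_ex _ _ _)[d [d0 dc]] :
    \forall d \near 0^'+, 0 < d /\ gexp k (b + d) < c.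
  near=> d; split; near: d; first exact: nbhs_right_gt.
  by move/cvgr_lt : cv; apply.
have H : b < b + d by lra.
by apply: filterS (usc _ H) => y /(gexp_lt k) /lt_trans; apply.
Unshelve. all: by end_near. Qed.

(** If [gexp k \o w] exceeds its chord by [e] at [t], it still exceeds the strictly concave [q]
    there, because [t * (1 - t) < 1]. As [q] has the same end values, the positive maximum [m] of
    the difference is attained at an inner point [s0], where [q + m] touches from above with second
    derivative [- (2 * e)]. *)
Lemma visc_subsolution_le_chord alpha w :
  0 < alpha -> alpha <= 1 ->
  (forall s, `[0, 1]%classic s -> forall c, w s < c ->
     \forall y \near within `[0, 1]%classic (nbhs s), w y < c) ->
  (forall t, t \in `]0, 1[ -> visc_Lop_ge0_at alpha w t) ->
  let k := (1 - alpha) / alpha in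
  forall t, t \in `]0, 1[ ->
    gexp k (w t) <= t * gexp k (w 1) + (1 - t) * gexp k (w 0).
Proof.
move=> a0 a1 usc visc k t; rewrite in_itv /= => /andP[t0 t1].
have k0 : 0 <= k by rewrite divr_ge0 ?subr_ge0// ltW.
rewrite leNgt; apply/negP.
set G1 := gexp k (w 1); set G0 := gexp k (w 0); rewrite -subr_gt0.
set e := gexp k (w t) - _ => e0.
pose q s := s * G1 + (1 - s) * G0 + e * (s * (1 - s)).
have cq : continuous q.
  move=> s.
  have c1 : (1 - y) @[y --> s] --> 1 - s.
    by apply: cvgB; [exact: cvg_cst|exact: cvg_id].
  apply: cvgD; first by apply: cvgD; apply: cvgMl => //; exact: cvg_id.
  by apply: cvgMr; apply: cvgM => //; exact: cvg_id.
have [s0 s0I s0max] : exists2 s, `[0, 1]%classic s &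
    forall y, `[0, 1]%classic y -> gexp k (w y) - q y <= gexp k (w s) - q s.
  apply: usc_attains_max; first exact: segment_compact.
    by exists 0; rewrite /= in_itv/= lexx ler01.
  move=> s sI c sc.
  (* The slack between [gexp k (w s) - q s] and [c] is shared equally between the two terms. *)
  have H1 : gexp k (w s) < (gexp k (w s) + (c + q s)) / 2 by lra.
  have H2 : (gexp k (w s) - c + q s) / 2 < q s by lra.
  have N2 : \forall y \near within `[0, 1]%classic (nbhs s),
      (gexp k (w s) - c + q s) / 2 < q y.
    by apply: cvg_within; move/cvgr_gt : (cq s); apply.
  by apply: filterS2 (usc_gexp (usc s sI) H1) N2 => y; lra.
set m := gexp k (w s0) - q s0 in s0max.
have m0 : 0 < m.
  apply: lt_le_trans (s0max t _); last by rewrite /= in_itv/= !ltW.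
  have -> : gexp k (w t) - q t = e * (1 - t * (1 - t)).
    by rewrite /q /e; ring.
  by rewrite mulr_gt0//; nra.
have s01 : 0 < s0 < 1.
  move: s0I; rewrite /= in_itv/= => /andP[s00 s01].
  rewrite !lt_neqAle s00 s01 !andbT.
  apply/andP; split; apply/eqP => s0E; move: m0; rewrite /m /q.
    by rewrite -s0E -/G0; lra.
  by rewrite s0E -/G1; lra.
have A0 : 0 < 1 + k * gexp k (w s0) by rewrite gexpE expR_gt0.
(* The derivative of [q] at [s0]: below, [p] is the Taylor expansion of [q + m] at [s0] plus a
   quartic term. *)
pose p1 := G1 - G0 + e * (1 - 2 * s0).
(* The quartic term keeps [1 + k * p] positive on the whole line, so that
   [glog k \o horner p] is C^2 there, without changing [p''] at [s0]. *)
have [C C0 HC] := quartic_gt0 p1 e k0 A0.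
(* [Y] is kept opaque, so that derivatives of [p] come from the product rule alone and the terms
   containing [Y] vanish at [s0]. *)
have [Y dY YE] : exists2 Y : {poly R}, Y^`() = 1 & forall s, Y.[s] = s - s0.
  by exists ('X - s0%:P) => [|s]; rewrite ?derivXsubC// !hornerE.
pose p : {poly R} := (gexp k (w s0))%:P + p1%:P * Y - e%:P * (Y * Y) +
  C%:P * (Y * Y * (Y * Y)).
have pE s : p.[s] = gexp k (w s0) + p1 * (s - s0) - e * (s - s0) ^+ 2 +
    C * (s - s0) ^+ 4 by rewrite /p !(hornerE, YE); ring.
have pq s : p.[s] = q s + m + C * (s - s0) ^+ 4.
  by rewrite pE /m /p1 /q; ring.
have ppos s : 0 < 1 + k * p.[s] by rewrite pE.
have [C2 L] := glog_horner_C2 ppos.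
have : 0 <= Lop alpha (glog k \o horner p) s0.
  apply: visc C2 _ _; first by rewrite in_itv.
    apply: (inc_inj (gexp_leE k)); rewrite /= glogK// pE subrr.
    by rewrite !expr0n/= !mulr0 subr0 !addr0.
  move=> s; rewrite in_itv/= => /andP[s1 s2].
  rewrite -(gexp_leE k) /= glogK// pq.
  have H4 : 0 <= C * (s - s0) ^+ 4 by rewrite mulr_ge0// exprn_even_ge0.
  have : gexp k (w s) - q s <= m by apply: s0max; rewrite /= in_itv/= !ltW.
  lra.
rewrite LopE// L pmulr_rge0// pmulr_lge0 ?invr_gt0// leNgt => /negP; apply.
have -> : p^`()^`().[s0] = - (2 * e).
  rewrite /p !(derivD, derivN, derivM, derivC, dY, polyC0, mul0r, mul1r, mulr1, add0r).
  by rewrite !(hornerD, hornerN, hornerM, hornerC, YE) subrr; ring.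
by rewrite oppr_lt0 mulr_gt0.
Unshelve. all: by end_near. Qed.

End comparison.

(** * Convexity along segments *)

Definition segment_convex (R : realType) (N : nat) (A : set 'rV[R]_N)
    (f : 'rV[R]_N -> R) :=
  forall x y t, A x -> A y -> 0 <= t <= 1 ->
    f (segpt x y t) <= t * f x + (1 - t) * f y.

Section several_variables.
Variables (R : realType) (N : nat).
Implicit Types (x y z h : 'rV[R]_N) (f u : 'rV[R]_N -> R) (A : set 'rV[R]_N).

Lemma convex_set_segpt A : @convex_set R 'rV[R]_N A ->
  forall x y t, A x -> A y -> 0 <= t <= 1 -> A (segpt x y t).
Proof.
move=> cA x y t Ax Ay /andP[t0 t1].
have /set_mem := cA x y (Itv01 t0 t1) (mem_set Ax) (mem_set Ay).
by [].
Qed.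

Lemma segptE x y t : segpt x y t = y + t *: (x - y).
Proof. by rewrite /segpt scalerBl scale1r scalerBr addrCA. Qed.

Lemma continuous_segpt x y : continuous (segpt x y).
Proof.
move=> t; rewrite /segpt; apply: cvgD; first by apply: cvgZr_tmp; exact: cvg_id.
apply: cvgZr_tmp; by apply: cvgB; [exact: cvg_cst|exact: cvg_id].
Qed.

(** When [x] is replaced by a nearby [x'], the point [g x'] is the other end that keeps the point of
    parameter [t] fixed. It tends to [z], so for some [x'] in [A] close to [x] both ends lie in
    [A]. *)
Lemma segpt_interior A x z t : open A -> @convex_set R 'rV[R]_N A ->
  closure A x -> A z -> 0 <= t < 1 -> A (segpt x z t).
Proof.
move=> oA cA clx Az /andP[t0 t1].
have t1' : 1 - t != 0 by rewrite gt_eqF// subr_gt0.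
pose g x' := z + (t / (1 - t)) *: (x - x').
have cg : {for x, continuous g}.
  apply: (cvgD (F := nbhs x)); first exact: cvg_cst.
  apply: (cvgZl_tmp (F := nbhs x)); apply: (cvgB (F := nbhs x)).
    exact: cvg_cst.
  exact: cvg_id.
have gx : g x = z by rewrite /g subrr scaler0 addr0.
have : \forall x' \near x, A (g x').
  by apply: cg; rewrite gx; exact: open_nbhs_nbhs.
move=> /clx[x' [Ax' Agx']].
have -> : segpt x z t = segpt x' (g x') t.
  rewrite /segpt /g scalerDr scalerA mulrC divfK// scalerBr.
  by rewrite [RHS]addrCA [t *: x' + _]addrC subrK addrC.
by apply: convex_set_segpt => //; rewrite t0 ltW.
Qed.

Lemma rV_norm_le h r : 0 <= r -> (`|h| <= r) <-> (forall j, `|h 0 j| <= r).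
Proof.
have -> : `|h| = mx_norm h by [].
move=> r0; rewrite mx_normrE; split.
  by move=> H j; apply: le_trans H; apply/bigmax_geP; right; exists (0, j).
by move=> H; apply/bigmax_leP; split=> // -[i j] _ /=; rewrite ord1.
Qed.

(* A point of the cube is moved to a vertex one coordinate at a time. *)
Lemma segment_convex_cube_bound A f x r : segment_convex A f -> 0 < r ->
  (forall h, `|h| <= r -> A (x + h)) ->
  exists M, forall h, `|h| <= r -> f (x + h) <= M.
Proof.
move=> cf r0 Ar.
pose V (s : {ffun 'I_N -> bool}) : 'rV[R]_N := \row_j (if s j then r else - r).
pose M := \sum_s `|f (x + V s)|; exists M.
(* Induction on the number [n] of leading coordinates left free: [n = 0] is a vertex, [n = N] the
   whole cube. *)
suff H n h : `|h| <= r -> (forall j : 'I_N, (n <= j)%N -> h 0 j = r \/ h 0 j = - r) ->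
    f (x + h) <= M.
  by move=> h hr; apply: (H N) => // j; rewrite leqNgt ltn_ord.
elim: n h => [|n IH] h hr hj.
  have -> : h = V [ffun j => h 0 j == r].
    apply/rowP => j; rewrite mxE ffunE; case: (hj j) => // ->; first by rewrite eqxx.
    by case: eqP.
  rewrite /M (bigD1 [ffun j => h 0 j == r])//=.
  by rewrite (le_trans (ler_norm _))// lerDl sumr_ge0.
have hjr : forall j, `|h 0 j| <= r by apply/(rV_norm_le h (ltW r0)).
have [nN|Nn] := ltnP n N; last first.
  by apply: IH => // j nj; have := leq_trans Nn nj; rewrite leqNgt ltn_ord.
pose i := Ordinal nN; pose hc c : 'rV[R]_N := \row_j (if j == i then c else h 0 j).
have hcr c : `|c| <= r -> `|hc c| <= r.
  by move=> cr; apply/(rV_norm_le _ (ltW r0)) => j; rewrite mxE; case: eqP.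
have fhc c : c = r \/ c = - r -> f (x + hc c) <= M.
  move=> cr; apply: IH => [|j nj].
    by apply: hcr; case: cr => ->; rewrite ?normrN ger0_norm// ltW.
  rewrite mxE; case: eqP => // /eqP ji; apply: hj.
  by rewrite ltn_neqAle nj andbT eq_sym.
have /ler_normlP[hi1 hi2] := hjr i.
pose t := (h 0 i + r) / (2 * r).
have t01 : 0 <= t <= 1.
  rewrite /t divr_ge0 ?mulr_ge0//=; [|lra|exact: ltW].
  by rewrite ler_pdivrMr ?mulr_gt0//; lra.
have -> : x + h = segpt (x + hc r) (x + hc (- r)) t.
  apply/rowP => j; rewrite !mxE; case: eqP => [->|_]; last by ring.
  by rewrite /t; field; rewrite gt_eqF.
have rr : `|r| <= r by rewrite ger0_norm// ltW.
apply: le_trans (cf _ _ _ _ _ t01) _.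
- exact/Ar/hcr.
- by apply/Ar/hcr; rewrite normrN.
move: t01 => /andP[t0 t1].
have H1 : t * f (x + hc r) <= t * M by apply: ler_wpM2l => //; apply: fhc; left.
have H2 : (1 - t) * f (x + hc (- r)) <= (1 - t) * M.
  by apply: ler_wpM2l; [rewrite subr_ge0|apply: fhc; right].
lra.
Qed.

Lemma open_cube A x : open A -> A x ->
  exists2 r, 0 < r & forall h, `|h| <= r -> A (x + h).
Proof.
move=> oA Ax; have /nbhs_ballP[e /= e0 eA] : nbhs x A by exact: open_nbhs_nbhs.
exists (e / 2); first by rewrite divr_gt0.
move=> h he; apply: eA; rewrite -ball_normE /= opprD addNKr normrN.
by apply: le_lt_trans he _; lra.
Qed.

(** An upper bound [M] on a cube of half-side [r] suffices: for [z] within [s * r] of [x], convexity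
    on two segments gives both one-sided estimates, each with error [s * (M - f x)]. *)
Lemma segment_convex_continuous A f : open A -> segment_convex A f ->
  forall x, A x -> {for x, continuous f}.
Proof.
move=> oA cf x Ax; have [r r0 Ar] := open_cube oA Ax.
have [M HM] := segment_convex_cube_bound cf r0 Ar.
have xM : f x <= M by rewrite -[x]addr0; apply: HM; rewrite normr0 ltW.
apply/(@cvgrPdist_lt _ _ _ (nbhs x)) => e e0.
(* The [+ 1] keeps the denominator positive when [M = f x]. *)
pose s := Num.min 1 (e / (2 * (M - f x + 1))).
have s0 : 0 < s by rewrite lt_min ltr01 divr_gt0// mulr_gt0//; lra.
have s1 : s <= 1 by rewrite ge_min lexx.
have se : s * (M - f x) < e.
  have : s * (2 * (M - f x + 1)) <= e.
    by rewrite -ler_pdivlMr ?mulr_gt0 ?ge_min ?lexx ?orbT//; lra.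
  nra.
apply/nbhs_ballP; exists (s * r) => /=; first exact: mulr_gt0.
move=> z; rewrite -ball_normE /= => zx.
(* [z] lies on the segment from [x] to [x + h], and [x] on the one from
   [z] to [x - h]. *)
pose h := s^-1 *: (z - x).
have sh : s *: h = z - x by rewrite /h scalerA divff ?scale1r// gt_eqF.
have hr : `|h| <= r.
  by rewrite normrZ gtr0_norm ?invr_gt0// ler_pdivrMl// distrC ltW.
have zE : z = segpt (x + h) x s by rewrite segptE addrAC subrr add0r sh addrC subrK.
have xE : x = segpt (x - h) z (s / (1 + s)).
  have -> : x - h = z - (1 + s) *: h.
    by rewrite scalerDl scale1r sh opprD opprB addrCA [z + _]addrC subrK addrC.
  rewrite segptE addrAC subrr add0r scalerN scalerA divfK ?sh ?subKr//.
  by rewrite gt_eqF// addr_gt0.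
have Ah : A (x + h) by exact: Ar.
have AhN : A (x - h) by apply: Ar; rewrite normrN.
have Az : A z.
  rewrite -[z](subrK x) addrC; apply: Ar; rewrite distrC ltW//.
  by apply: lt_le_trans zx _; rewrite ler_piMl// ltW.
have H1 : f z <= s * M + (1 - s) * f x.
  rewrite [in f z]zE; apply: le_trans (cf _ _ _ Ah Ax _) _; first by rewrite ltW.
  by rewrite lerD2r ler_wpM2l ?HM// ltW.
have H2 : (1 + s) * f x <= s * M + f z.
  have d0 : 0 < 1 + s by lra.
  have s01 : 0 <= s / (1 + s) <= 1.
    apply/andP; split; first by apply: divr_ge0; exact: ltW.
    by rewrite ler_pdivrMr//; lra.
  have := cf _ _ _ AhN Az s01; rewrite -xE => H.
  have : (1 + s) * f x <= (1 + s) * (s / (1 + s) * f (x - h) + (1 - s / (1 + s)) * f z).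
    by rewrite ler_pM2l.
  have -> : (1 + s) * (s / (1 + s) * f (x - h) + (1 - s / (1 + s)) * f z) =
     s * f (x - h) + f z by field; rewrite gt_eqF.
  have : s * f (x - h) <= s * M by rewrite ler_wpM2l ?HM ?normrN// ltW.
  lra.
by rewrite ltr_norml; apply/andP; split; lra.
Qed.

(** Prolong the segment from [x] through [y] by the length [M^-1], up to [z]. The slope from [x] to
    [y] is at most that from [x] to [z], where [f] varies by at most [2 * M] over a length of at
    least [M^-1]. *)
Lemma segment_convex_dist A f (M : R) x y : segment_convex A f -> 0 < M ->
  A x -> `|f x| <= M ->
  (forall z, `|z - y| <= M^-1 -> A z /\ `|f z| <= M) ->
  f y - f x <= 2 * M ^+ 2 * `|y - x|.
Proof.
move=> cf M0 Ax fx Hy; have [->|yx] := eqVneq y x.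
  by rewrite !subrr normr0 mulr0.
have rho0 : 0 < `|y - x| by rewrite normr_gt0 subr_eq0.
set rho := `|y - x| in rho0 *; set d := M^-1 in Hy.
have d0 : 0 < d by rewrite invr_gt0.
pose z := y + (d / rho) *: (y - x).
have [Az fz] : A z /\ `|f z| <= M.
  apply: Hy; rewrite /z addrAC subrr add0r normrZ gtr0_norm ?divr_gt0//.
  by rewrite divfK// gt_eqF.
have rd0 : 0 < rho + d by rewrite addr_gt0.
have yE : y = segpt z x (rho / (rho + d)).
  apply/rowP => j; rewrite /z /segpt !mxE.
  by field; rewrite !gt_eqF.
have s01 : 0 <= rho / (rho + d) <= 1.
  apply/andP; split; first by apply: divr_ge0; exact: ltW.
  by rewrite ler_pdivrMr// mul1r lerDl ltW.
have := cf _ _ _ Az Ax s01; rewrite -yE => H.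
have H1 : f y - f x <= rho / (rho + d) * (f z - f x) by lra.
apply: le_trans H1 _.
have -> : 2 * M ^+ 2 * rho = (rho / d) * (2 * M).
  by rewrite /d; field; rewrite gt_eqF.
move: fx fz => /ler_normlP[? ?] /ler_normlP[? ?].
apply: (@le_trans _ _ (rho / (rho + d) * (2 * M))).
  by apply: ler_wpM2l; [case/andP: s01|lra].
apply: ler_wpM2r; first lra.
by rewrite ler_pM2l// lef_pV2 ?posrE// lerDr ltW.
Qed.

End several_variables.

(** * Alpha-convexity and viscosity subsolutions *)

Section alpha_convexity.
Variables (R : realType) (N : nat) (alpha : R) (Omega : set 'rV[R]_N).
Hypotheses (alpha_gt0 : 0 < alpha) (alpha_le1 : alpha <= 1).
Hypotheses (Omega_open : open Omega) (Omega_convex : @convex_set R 'rV[R]_N Omega).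
Let k := (1 - alpha) / alpha.
Implicit Type u : 'rV[R]_N -> R.

Let k_ge0 : 0 <= k.
Proof. by apply: divr_ge0; [rewrite subr_ge0|exact: ltW]. Qed.

(** From left to right a Dirichlet solution must exist, since alpha-convexity speaks of all
    solutions; conversely, [gexp k] turns any solution into the chord. *)
Lemma alpha_convexE u :
  alpha_convex alpha Omega u <-> segment_convex (closure Omega) (gexp k \o u).
Proof.
split=> [au x y t clx cly /andP[t0 t1]|gu x y clx cly v solv t t01].
  have [->|tn0] := eqVneq t 0.
    by rewrite segptE scale0r addr0 mul0r add0r subr0 mul1r.
  have [->|tn1] := eqVneq t 1.
    by rewrite segptE scale1r addrC subrK subrr mul0r addr0 mul1r.
  have t01 : t \in `]0, 1[ by rewrite in_itv/= !lt_neqAle eq_sym tn0 t0 tn1 t1.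
  have [v solv] := dirichlet_solution_exists (u y) (u x) alpha_gt0 alpha_le1.
  rewrite /= -(dirichlet_solution_gexp alpha_gt0 solv t01) gexp_leE.
  exact: (au x y clx cly v solv t t01).
rewrite -(gexp_leE k) (dirichlet_solution_gexp alpha_gt0 solv t01).
by apply: gu => //; move: t01; rewrite in_itv/= => /andP[? ?]; rewrite !ltW.
Qed.

Lemma gexp_comp_continuous (T : topologicalType) (f : T -> R) x :
  {for x, continuous (gexp k \o f)} -> {for x, continuous f}.
Proof.
move=> cf; apply/(@cvgrPdist_lt _ _ _ (nbhs x)) => e e0.
have lt1 : gexp k (f x) < gexp k (f x + e) by apply: gexp_lt; lra.
have lt2 : gexp k (f x - e) < gexp k (f x) by apply: gexp_lt; lra.
near=> y; rewrite ltr_norml; apply/andP; split.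
  suff : f y < f x + e by lra.
  by rewrite -(gexp_ltE k); near: y; move/cvgr_lt : cf; apply.
suff : f x - e < f y by lra.
by rewrite -(gexp_ltE k); near: y; move/cvgr_gt : cf; apply.
Unshelve. all: by end_near. Qed.

Lemma segment_convexW u : alpha_convex alpha Omega u ->
  segment_convex Omega (gexp k \o u).
Proof.
by move/alpha_convexE => H x y t Ox Oy; apply: H; exact: subset_closure.
Qed.

Lemma alpha_convex_continuous u : alpha_convex alpha Omega u ->
  forall x, Omega x -> {for x, continuous u}.
Proof.
move=> /segment_convexW gu x Ox; apply: gexp_comp_continuous.
exact: segment_convex_continuous Ox.
Qed.

(** A single [M] serves as bound of both functions and as inverse of the margin around [K], so one
    compactness argument with [M] tending to infinity yields all three. It is applied to [u] and
    [gexp k \o u]. *)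
Lemma compact_margin (K : set 'rV[R]_N) (f g : 'rV[R]_N -> R) :
  compact K -> K `<=` Omega ->
  (forall x, Omega x -> {for x, continuous f}) ->
  (forall x, Omega x -> {for x, continuous g}) ->
  exists2 M, 0 < M & forall x, K x ->
    forall z, `|z - x| <= M^-1 -> [/\ Omega z, `|f z| <= M & `|g z| <= M].
Proof.
move=> /compact_near_coveringP cK KO cf cg.
pose P (M : R) x := forall z, `|z - x| <= M^-1 ->
  [/\ Omega z, `|f z| <= M & `|g z| <= M].
have HP : \forall M \near +oo, K `<=` P M.
  apply: cK => x Kx; have Ox := KO x Kx.
  have : \forall z \near x, [/\ Omega z, `|f z| < `|f x| + 1 & `|g z| < `|g x| + 1].
    near=> z; split; near: z; first exact: open_nbhs_nbhs.
      by have /cvg_norm/cvgr_lt := cf x Ox; apply; rewrite ltrDl.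
    by have /cvg_norm/cvgr_lt := cg x Ox; apply; rewrite ltrDl.
  move=> /nbhs_ballP[e /= e0 He].
  (* Half of [e] is for the distance from [x] to [y], half for that from [y] to [z]. *)
  exists (ball x (e / 2),
    [set M | [/\ 2 / e < M, `|f x| + 1 < M & `|g x| + 1 < M]]).
    split=> /=; first by apply: nbhsx_ballx; rewrite divr_gt0.
    by near=> M; split; near: M; apply: nbhs_pinfty_gt; exact: num_real.
  move=> [y M] [/= xy [eM fM gM]] z zy.
  have M0 : 0 < M by apply: lt_trans eM; rewrite divr_gt0.
  have Me : M^-1 < e / 2 by rewrite -[e / 2]invrK ltf_pV2 ?posrE ?invf_div ?divr_gt0.
  have [|Oz fz gz] := He z.
    rewrite -ball_normE /= in xy *.
    rewrite -(subrK y x) -addrA (le_lt_trans (ler_normD _ _))// [ltRHS]splitr.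
    by rewrite ltrD// distrC (le_lt_trans zy).
  by split=> //; apply/ltW; [exact: lt_trans fM|exact: lt_trans gM].
have /(@filter_ex _ _ _)[M [M0 HM]] : \forall M \near +oo, 0 < M /\ K `<=` P M.
  near=> M; split; near: M => //; apply: nbhs_pinfty_gt; exact: num_real.
by exists M => // x /HM.
Unshelve. all: by end_near. Qed.

Lemma alpha_convex_lipschitz u : alpha_convex alpha Omega u ->
  lipschitz_on_compacts Omega u.
Proof.
move=> au K cK KO.
have gu := segment_convexW au.
have [M M0 HM] := compact_margin cK KO (alpha_convex_continuous au)
  (segment_convex_continuous Omega_open gu).
have lip x y : K x -> K y ->
    gexp k (u y) - gexp k (u x) <= 2 * M ^+ 2 * `|y - x|.
  move=> Kx Ky; apply: (segment_convex_dist gu) => //.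
  - exact: KO.
  - by have [|] := HM x Kx x; rewrite // subrr normr0 invr_ge0 ltW.
  - by move=> z /(HM y Ky)[].
(* Product of the Lipschitz constants of the inverse of [gexp k] on [[-M, M]] and of [gexp k \o u]
   on [K]. *)
pose L := expR (k * M) * (2 * M ^+ 2).
rewrite /lipschitz_on; near=> L'; move=> [x y] [/= Kx Ky].
have LL : L <= L' by near: L'; apply: nbhs_pinfty_ge; exact: num_real.
apply: (@le_trans _ _ (L * `|x - y|)); last by rewrite ler_wpM2r.
have bu z : K z -> `|u z| <= M.
  by move=> Kz; have [|] := HM z Kz z; rewrite // subrr normr0 invr_ge0 ltW.
apply: le_trans (dist_gexp k_ge0 (bu _ Kx) (bu _ Ky)) _.
rewrite /L -mulrA ler_wpM2l ?expR_ge0//.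
have := lip _ _ Kx Ky; have := lip _ _ Ky Kx; rewrite (distrC y x) => H1 H2.
by rewrite ler_norml; apply/andP; split; lra.
Unshelve. all: by end_near. Qed.

Lemma alpha_convex_visc u : alpha_convex alpha Omega u ->
  visc_subsolution alpha Omega u.
Proof.
move=> au; split=> [x Ox c uc|z Oz x y clx cly t t01 zE phi C2 phit phiu].
  apply: cvg_within; have /cvgr_lt := alpha_convex_continuous au Ox; exact.
rewrite LopE// -/k pmulr_rge0//.
have d1 (s : R) : is_derive s 1 phi (derive1 phi s).
  by have [H _ _] := C2 s Logic.I; exact: derivable_is_derive1 H.
have d2 (s : R) : is_derive s 1 (derive1 phi) (derive1n 2 phi s).
  by have [_ H _] := C2 s Logic.I; exact: derivable_is_derive1 H.
have cd f f' : (forall s : R, is_derive s 1 f (f' s)) -> continuous (f : R -> R).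
  move=> H s; apply: differentiable_continuous; apply/derivable1_diffP.
  by have [] := H s.
(* With this positive factor the goal is the sign of the second derivative of [gexp k \o phi] at
   [t]. *)
rewrite -(pmulr_rge0 _ (expR_gt0 (k * phi t))).
apply: (@symdiff_ge0_derive2 _ (gexp k \o phi)
  (fun s => expR (k * phi s) * derive1 phi s)
  (fun s => expR (k * phi s) * (derive1n 2 phi s + k * derive1 phi s ^+ 2))).
- by move=> s; exact: is_derive_gexp_comp.
- by move=> s; exact: is_derive2_gexp_comp.
- have c0 : {for t, continuous (fun s => k * phi s)}.
    by apply: cvgM; [exact: cvg_cst|exact: (cd _ _ d1)].
  have c1 := cd _ _ d2 t.
  have [_ _ c2] := C2 t Logic.I.
  apply: cvgM; first exact: continuous_comp c0 (@continuous_expR _ _).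
  by apply: cvgD => //; apply: cvgM; [exact: cvg_cst|exact: (cvgM c1 c1)].
have {}t01 : 0 < t < 1 by move: t01; rewrite in_itv.
have cO : \forall s \near t, Omega (segpt x y s).
  have := @continuous_segpt _ _ x y t; apply.
  by rewrite -zE; exact: open_nbhs_nbhs.
have cp : (t + h) @[h --> 0^'+] --> t.
  apply: cvg_at_right_filter; rewrite -[in X in _ --> X](addr0 t).
  by apply: cvgD; [exact: cvg_cst|exact: cvg_id].
have cm : (t - h) @[h --> 0^'+] --> t.
  apply: cvg_at_right_filter; rewrite -[in X in _ --> X](subr0 t).
  by apply: cvgB; [exact: cvg_cst|exact: cvg_id].
(* The ends [x] and [y] may lie on the boundary, but for small [h] the points at [t + h] and [t - h]
   are in [Omega]. Midpoint convexity there passes to [phi], which equals [u] at the midpoint and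
   dominates it at both ends. *)
near=> h.
have h0 : 0 < h by near: h; exact: nbhs_right_gt.
have ht : h < t by near: h; apply: nbhs_right_lt; lra.
have h1t : h < 1 - t by near: h; apply: nbhs_right_lt; lra.
have Op : Omega (segpt x y (t + h)) by near: h; exact: cp cO.
have Om : Omega (segpt x y (t - h)) by near: h; exact: cm cO.
have le_phi s : 0 < s < 1 -> gexp k (u (segpt x y s)) <= gexp k (phi s).
  by move=> s01; rewrite gexp_leE; apply: phiu; rewrite in_itv.
have Hp := le_phi (t + h); have Hm := le_phi (t - h).
have half : 0 <= (2^-1 : R) <= 1 by rewrite invr_ge0 ler0n invf_le1 ?ler1n.
have := segment_convexW au Op Om half; rewrite /= phit.
have -> : segpt (segpt x y (t + h)) (segpt x y (t - h)) 2^-1 = segpt x y t.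
  by apply/rowP => j; rewrite !mxE; field.
have /andP[t0 t1] := t01.
have /Hp {}Hp : 0 < t + h < 1 by rewrite addr_gt0//= addrC -ltrBrDr.
have /Hm {}Hm : 0 < t - h < 1.
  by rewrite subr_gt0 ht /= (le_lt_trans _ t1)// gerBl ltW.
lra.
Unshelve. all: by end_near. Qed.

End alpha_convexity.

(** * From viscosity subsolutions to alpha-convexity *)

Section viscosity.
Variables (R : realType) (N : nat) (alpha : R) (Omega : set 'rV[R]_N).
Hypotheses (alpha_gt0 : 0 < alpha) (alpha_le1 : alpha <= 1).
Hypotheses (Omega_open : open Omega) (Omega_convex : @convex_set R 'rV[R]_N Omega).
Let k := (1 - alpha) / alpha.
Implicit Type u : 'rV[R]_N -> R.

(** The one-dimensional comparison along the segment. Semicontinuity on the closure carries it up to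
    the end points, which may be boundary points. *)
Lemma visc_le_chord_interior u x y :
  usc_on (closure Omega) u -> visc_subsolution alpha Omega u ->
  closure Omega x -> closure Omega y ->
  (forall s, 0 < s < 1 -> Omega (segpt x y s)) -> forall t, 0 < t < 1 ->
  gexp k (u (segpt x y t)) <= t * gexp k (u x) + (1 - t) * gexp k (u y).
Proof.
move=> usc [_ visc] clx cly xyO t t01.
have e0 : segpt x y 0 = y by rewrite segptE scale0r addr0.
have e1 : segpt x y 1 = x by rewrite segptE scale1r addrC subrK.
have cl s : `[0, 1]%classic s -> closure Omega (segpt x y s).
  rewrite /= in_itv/= => /andP[s0 s1].
  have [->|sn0] := eqVneq s 0; first by rewrite e0.
  have [->|sn1] := eqVneq s 1; first by rewrite e1.
  by apply/subset_closure/xyO; rewrite !lt_neqAle eq_sym sn0 s0 sn1 s1.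
have := @visc_subsolution_le_chord R alpha (u \o segpt x y) alpha_gt0 alpha_le1.
rewrite /= e0 e1; apply; last by rewrite in_itv.
- move=> s sI c uc.
  have Hs : \forall s' \near s, closure Omega (segpt x y s') ->
      u (segpt x y s') < c.
    exact: (@continuous_segpt R N x y s _ (usc _ (cl s sI) _ uc)).
  rewrite near_withinE; apply: filterS Hs => s' H s'I.
  exact/H/cl.
- move=> s s01; have Os : Omega (segpt x y s).
    by apply: xyO; move: s01; rewrite in_itv.
  exact: (visc _ Os x y clx cly s s01 erefl).
Qed.

(** Any inner point lies between the given point of [Omega] and an end in the closure. Hence an open
    segment is either contained in [Omega] or disjoint from it. *)
Lemma segpt_meets_interior x y t : closure Omega x -> closure Omega y ->
  0 < t < 1 -> Omega (segpt x y t) ->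
  forall s, 0 < s < 1 -> Omega (segpt x y s).
Proof.
move=> clx cly /andP[t0 t1] Oz s /andP[s0 s1].
have [st|ts] := leP s t.
  have -> : segpt x y s = segpt y (segpt x y t) (1 - s / t).
    by apply/rowP => j; rewrite !mxE; field; rewrite gt_eqF.
  apply: segpt_interior => //.
  by rewrite subr_ge0 ler_pdivrMr// mul1r st ltrBlDr ltrDl divr_gt0.
have t10 : 0 < 1 - t by rewrite subr_gt0.
have -> : segpt x y s = segpt x (segpt x y t) ((s - t) / (1 - t)).
  by apply/rowP => j; rewrite !mxE; field; rewrite gt_eqF.
apply: segpt_interior => //; apply/andP; split.
  by apply: divr_ge0; [rewrite subr_ge0 ltW|exact: ltW].
by rewrite ltr_pdivrMr// mul1r ltrD2r.
Qed.

Lemma cvg_segpt0 (o p : 'rV[R]_N) : segpt o p r @[r --> 0^'+] --> p.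
Proof.
apply: cvg_at_right_filter.
rewrite -[in X in _ --> X](_ : segpt o p 0 = p); first exact: continuous_segpt.
by rewrite segptE scale0r addr0.
Qed.

Lemma near_segpt_interior o p : Omega o -> closure Omega p ->
  \forall r \near 0^'+, Omega (segpt o p r).
Proof.
move=> Oo clp; near=> r; have -> : segpt o p r = segpt p o (1 - r).
  by apply/rowP => j; rewrite !mxE; ring.
have r0 : 0 < r by near: r; exact: nbhs_right_gt.
have r1 : r < 1 by near: r; exact: nbhs_right_lt.
by apply: segpt_interior => //; apply/andP; split; lra.
Unshelve. all: by end_near. Qed.

Lemma visc_alpha_convex u : Omega !=set0 ->
  usc_on (closure Omega) u -> continuous_on_flat_boundary Omega u ->
  visc_subsolution alpha Omega u -> alpha_convex alpha Omega u.
Proof.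
move=> [ o Oo] usc flat visc; apply/(alpha_convexE _ alpha_gt0 alpha_le1).
move=> x y t clx cly /andP[t0 t1]; rewrite -/k /=.
have [->|tn0] := eqVneq t 0.
  by rewrite segptE scale0r addr0 mul0r add0r subr0 mul1r.
have [->|tn1] := eqVneq t 1.
  by rewrite segptE scale1r addrC subrK subrr mul0r addr0 mul1r.
have t01 : 0 < t < 1 by rewrite !lt_neqAle eq_sym tn0 t0 tn1 t1.
have [->|/eqP xy] := eqVneq x y.
  by rewrite segptE subrr scaler0 addr0 -mulrDl addrC subrK mul1r.
set z := segpt x y t.
have [Oz|nOz] := pselect (Omega z).
  by apply: visc_le_chord_interior => //; exact: segpt_meets_interior Oz.
have cz : gexp k (u q) @[q --> within (closure Omega) (nbhs z)] --> gexp k (u z).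
  apply: continuous_cvg; first exact: continuous_gexp.
  by apply: flat => //; rewrite in_itv.
rewrite leNgt; apply/negP; set G := _ + _ => Gz.
(* Half of the excess over the chord: an error [d] at the inner point and another [d] at the ends
   give a strict inequality that contradicts it. *)
pose d := (gexp k (u z) - G) / 2.
have d0 : 0 < d by rewrite divr_gt0// subr_gt0.
(* The contraction towards [o] preserves ratios on segments, so [z] moves to the point of parameter
   [t] on a segment inside [Omega]. *)
have zE r : segpt o z r = segpt (segpt o x r) (segpt o y r) t.
  by apply/rowP => j; rewrite !mxE; ring.
have le (s : R) : 0 < s < 1 -> 0 <= s <= 1 by move=> /andP[? ?]; rewrite !ltW.
have near_ub p : closure Omega p -> \forall r \near 0^'+,
    Omega (segpt o p r) /\ gexp k (u (segpt o p r)) < gexp k (u p) + d.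
  move=> clp; have HO := near_segpt_interior Oo clp.
  have pd : gexp k (u p) < gexp k (u p) + d by rewrite ltrDl.
  have Hu : \forall r \near 0^'+, closure Omega (segpt o p r) ->
      gexp k (u (segpt o p r)) < gexp k (u p) + d.
    have : \forall q \near within (closure Omega) (nbhs p),
        gexp k (u q) < gexp k (u p) + d by exact: usc_gexp (usc p clp) _ pd.
    exact: cvg_segpt0.
  apply: filterS2 HO Hu => r Or ur.
  by split=> //; exact/ur/subset_closure.
have near_lb : \forall r \near 0^'+, closure Omega (segpt o z r) ->
    gexp k (u z) - d < gexp k (u (segpt o z r)).
  have zd : gexp k (u z) - d < gexp k (u z) by rewrite ltrBlDr ltrDl.
  have : \forall q \near within (closure Omega) (nbhs z),
      gexp k (u z) - d < gexp k (u q) by exact: cvgr_gt cz _ zd.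
  exact: cvg_segpt0.
near (0 : R)^'+ => r.
have [Ox ux] : Omega (segpt o x r) /\ gexp k (u (segpt o x r)) < gexp k (u x) + d.
  by near: r; exact: near_ub.
have [Oy uy] : Omega (segpt o y r) /\ gexp k (u (segpt o y r)) < gexp k (u y) + d.
  by near: r; exact: near_ub.
have : closure Omega (segpt o z r) ->
    gexp k (u z) - d < gexp k (u (segpt o z r)) by near: r.
rewrite zE; set ur := gexp k (u (segpt _ _ t)) => H1.
have {}H1 : gexp k (u z) - d < ur.
  by apply/H1/subset_closure; apply: convex_set_segpt => //; rewrite t0 t1.
have := @visc_le_chord_interior u (segpt o x r) (segpt o y r) usc visc
  (subset_closure Ox) (subset_closure Oy)
  (fun s s01 => convex_set_segpt Omega_convex Ox Oy (le s s01)) t t01.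
rewrite -/ur => H2.
have H3 : t * gexp k (u (segpt o x r)) <= t * (gexp k (u x) + d).
  by rewrite ler_wpM2l// ltW.
have H4 : (1 - t) * gexp k (u (segpt o y r)) <= (1 - t) * (gexp k (u y) + d).
  by rewrite ler_wpM2l ?subr_ge0// ltW.
move: H1 H2 H3 H4; rewrite /d /G; lra.
Unshelve. all: by end_near. Qed.

End viscosity.

Unset Implicit Arguments.

Theorem theorem1p2 (R : realType) (N : nat) (alpha : R) (Omega : set 'rV[R]_N)
  (hN : (0 < N)%N) (halpha : 0 <= alpha <= 1) (halpha0 : alpha != 0)
  (Omega_open : open Omega) (Omega_neq0 : Omega !=set0)
  (Omega_convex : @convex_set R 'rV[R]_N Omega) :
  (forall u : 'rV[R]_N -> R,
     alpha_convex alpha Omega u -> lipschitz_on_compacts Omega u) /\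
  (forall u : 'rV[R]_N -> R,
     alpha_convex alpha Omega u -> visc_subsolution alpha Omega u) /\
  (forall u : 'rV[R]_N -> R,
     usc_on (closure Omega) u -> continuous_on_flat_boundary Omega u ->
     (alpha_convex alpha Omega u <-> visc_subsolution alpha Omega u)).
Proof.
have /andP[a0 a1] := halpha.
have agt0 : 0 < alpha by rewrite lt_neqAle eq_sym halpha0 a0.
split; first by move=> u; exact: alpha_convex_lipschitz.
split; first by move=> u; exact: alpha_convex_visc.
move=> u usc flat; split; first exact: alpha_convex_visc.
exact: visc_alpha_convex.
Qed.
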